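(* There exists a universal constant $K>0$ such that for all integers $n,k\ge1$ and every Boolean function $f\colon\{-1,1\}^n\to\{-1,1\}$ that can be expressed as a read-$k$ DNF, $$\mathbb{H}_\infty(\hat f^2)\;\le\; K\,(1+\log_2 k)\cdot \mathsf{Inf}(f).$$
   Context: For $S\subseteq[n]$, $\hat f(S)=\mathbb{E}_x[f(x)\prod_{i\in S}x_i]$ with $x$ uniform in $\{-1,1\}^n$. The Fourier min-entropy of $f$ is $\mathbb{H}_\infty(\hat f^2)=\min_{S:\hat f(S)\ne0}\log_2\frac{1}{\hat f(S)^2}$. The total influence is $\mathsf{Inf}(f)=\sum_{S\subseteq[n]}|S|\hat f(S)^2=\sum_{i=1}^n\Pr_x[f(x)\ne f(x^{(i)})]$, where $x^{(i)}$ is $x$ with the $i$-th coordinate flipped. Convention: the value $-1$ stands for ''true'' and $1$ for ''false''. A DNF is a disjunction of terms, each term being a conjunction of literals (variables or negated variables). A read-$k$ DNF is a DNF in which every variable appears (negated or un-negated) in at most $k$ terms. *)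

(* Defs.v *)
From HB Require Import structures.
From mathcomp Require Import all_boot all_order all_algebra.
From mathcomp Require Import reals constructive_ereal exp.

Set Implicit Arguments.
Unset Strict Implicit.
Unset Printing Implicit Defensive.

Import Order.TTheory GRing.Theory Num.Theory.
Local Open Scope ring_scope.

(* The two-point set {-1, 1} is represented by [bool], with [true] standing
   for -1 and [false] for 1; [pm1 R] is the corresponding embedding in R. *)
Definition cube (n : nat) := {ffun 'I_n -> bool}.

Definition pm1 (R : realType) (b : bool) : R := (-1) ^+ b.

Section Fourier.
Variables (R : realType) (n : nat).

Definition expectation (g : cube n -> R) : R :=
  (\sum_(x : cube n) g x) / #|{: cube n}|%:R.

Definition fourier (f : cube n -> bool) (S : {set 'I_n}) : R :=
  expectation (fun x => pm1 R (f x) * \prod_(i in S) pm1 R (x i)).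

Definition log2 (t : R) : R := ln t / ln 2.

(* The neutral element +oo is never the result: by Parseval, some Fourier
   coefficient is nonzero. *)
Definition min_entropy (f : cube n -> bool) : \bar R :=
  \big[Order.min/+oo%E]_(S : {set 'I_n} | fourier f S != 0)
    (log2 (1 / fourier f S ^+ 2))%:E.

Definition total_influence (f : cube n -> bool) : R :=
  \sum_(S : {set 'I_n}) #|S|%:R * fourier f S ^+ 2.

End Fourier.

(* The literal (i, true) is the variable x_i; (i, false) is its negation.
   The empty term is true and the empty DNF is false. *)
Definition literal (n : nat) := ('I_n * bool)%type.
Definition term (n : nat) := seq (literal n).
Definition dnf (n : nat) := seq (term n).

Definition eval_literal (n : nat) (x : cube n) (l : literal n) : bool :=
  if l.2 then x l.1 else ~~ x l.1.

Definition eval_term (n : nat) (x : cube n) (t : term n) : bool :=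
  all (eval_literal x) t.

Definition eval_dnf (n : nat) (phi : dnf n) (x : cube n) : bool :=
  has (eval_term x) phi.

Definition appears_in (n : nat) (i : 'I_n) (t : term n) : bool :=
  has (fun l => l.1 == i) t.

Definition read_dnf (n k : nat) (phi : dnf n) : Prop :=
  forall i : 'I_n, (count (appears_in i) phi <= k)%N.

Definition has_read_dnf (n k : nat) (f : cube n -> bool) : Prop :=
  exists2 phi : dnf n, read_dnf k phi & eval_dnf phi =1 f.

(* Main.v *)
(** Let M be the largest |fourier f S|. Expanding the literals of a term T of the
    DNF as (1 +- x_i) / 2 shows |E[f 1_T]| <= M; since f = -1 on T this says
    Pr[T] <= M. A coordinate matters at x only if one of the at most k terms
    mentioning it holds at x or at the flipped point, so every influence is at
    most 2 k M. On the other hand the KKL inequality gives a coordinate of influence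
    2^(-O(Inf f)) as soon as the variance of f is at least 1/2; hence
    M >= 2^(-O(Inf f)) / k. If the variance is below 1/2, the coefficient at the
    empty set is large enough. *)

Require Import Defs.
From mathcomp Require Import all_boot all_order all_algebra.
From mathcomp Require Import reals constructive_ereal exp.
From mathcomp Require Import ring lra.

Set Implicit Arguments.
Unset Strict Implicit.
Unset Printing Implicit Defensive.

Import Order.TTheory GRing.Theory Num.Theory.
Local Open Scope ring_scope.

(** * Expectation over the cube and coordinate flips *)

Section Cube.
Context {R : realType} {n : nat}.
Implicit Types (g h : cube n -> R) (x y : cube n) (i : 'I_n) (S A : {set 'I_n}).

Local Notation E := (@expectation R n).
Local Notation sgn := (pm1 R).

Lemma pm1_sqr b : sgn b * sgn b = 1.
Proof. by rewrite /pm1; case: b; rewrite ?expr1 ?expr0; ring. Qed.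

Lemma pm1_addb a b : sgn (a (+) b) = sgn a * sgn b.
Proof. by rewrite /pm1 signr_addb. Qed.

Lemma card_cube_gt0 : 0 < #|{: cube n}|%:R :> R.
Proof. by rewrite ltr0n; apply/card_gt0P; exists [ffun => false]. Qed.

Lemma eq_expectation g h : g =1 h -> E g = E h.
Proof. by move=> gh; rewrite /expectation; under eq_bigr do rewrite gh. Qed.

Lemma expectationD g h : E (fun x => g x + h x) = E g + E h.
Proof. by rewrite /expectation big_split mulrDl. Qed.

Lemma expectationZ a g : E (fun x => a * g x) = a * E g.
Proof. by rewrite /expectation -mulr_sumr mulrA. Qed.

Lemma expectation_sum (I : Type) (r : seq I) (P : pred I) (F : I -> cube n -> R) :
  E (fun x => \sum_(j <- r | P j) F j x) = \sum_(j <- r | P j) E (F j).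
Proof. by rewrite /expectation exchange_big mulr_suml. Qed.

Lemma expectation1 : E (fun=> 1) = 1.
Proof.
by rewrite /expectation sumr_const -[X in X / _]/(_%:R) divff ?gt_eqF ?card_cube_gt0.
Qed.

Lemma expectation_ge0 g : (forall x, 0 <= g x) -> 0 <= E g.
Proof.
by move=> g0; rewrite divr_ge0 ?ler0n // sumr_ge0 // => x _; apply: g0.
Qed.

Lemma ler_expectation g h : (forall x, g x <= h x) -> E g <= E h.
Proof.
move=> gh; rewrite ler_pM2r ?invr_gt0 ?card_cube_gt0 //.
by apply: ler_sum => x _; apply: gh.
Qed.

(** Lagrange's identity: for independent x and y, the mean of (g x h y - g y h x)^2 is 2 (E[g^2]
    E[h^2] - E[g h]^2). *)
Lemma expectation_cauchy_schwarz g h :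
  E (fun x => g x * h x) ^+ 2 <= E (fun x => g x ^+ 2) * E (fun x => h x ^+ 2).
Proof.
have : 0 <= E (fun x => E (fun y => (g x * h y - g y * h x) ^+ 2)).
  by do 2![apply: expectation_ge0 => ?]; exact: sqr_ge0.
set a := E (fun x => g x ^+ 2); set b := E (fun x => h x ^+ 2).
set c := E (fun x => g x * h x).
rewrite (eq_expectation (h := fun x => b * g x ^+ 2 + (- 2 * c) * (g x * h x)
    + a * h x ^+ 2)); last first.
  move=> x; transitivity (g x ^+ 2 * b + (- 2 * g x * h x) * c + h x ^+ 2 * a);
    last by ring.
  rewrite /a /b /c -!expectationZ -!expectationD.
  by apply: eq_expectation => y; ring.
rewrite !expectationD !expectationZ -/a -/b -/c; lra.
Qed.

Definition flip i x : cube n := [ffun j => x j (+) (j == i)].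

Lemma flipK i : involutive (flip i).
Proof. by move=> x; apply/ffunP => j; rewrite !ffunE -addbA addbb addbF. Qed.

Lemma expectation_flip i g : E (fun x => g (flip i x)) = E g.
Proof.
by rewrite /expectation [in RHS](reindex_inj (inv_inj (flipK i))).
Qed.

(** * Characters and Parseval's identity *)

Definition chi S x : R := \prod_(i in S) sgn (x i).

(** Extends [fourier] to real-valued functions, so that Parseval also covers [laplacian]; for g =
    sgn (f x) it is [fourier R f S] by conversion. *)
Definition fcoef g S : R := E (fun x => g x * chi S x).

Lemma chi_flip_in i S x : i \in S -> chi S (flip i x) = - chi S x.
Proof.
move=> iS; rewrite /chi (bigD1 i) //= [in RHS](bigD1 i) //= ffunE eqxx pm1_addb.
rewrite /pm1 expr1 mulrN1 mulNr; congr (- (_ * _)).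
by apply: eq_bigr => j /andP[_ /negPf ji]; rewrite ffunE ji addbF.
Qed.

Lemma chi_flip_notin i S x : i \notin S -> chi S (flip i x) = chi S x.
Proof.
move=> iS; apply: eq_bigr => j jS; rewrite ffunE.
by case: eqP => [ji|_]; [rewrite -ji jS in iS | rewrite addbF].
Qed.

Lemma chiU1 i S x : i \notin S -> chi (i |: S) x = sgn (x i) * chi S x.
Proof. exact: big_setU1. Qed.

Lemma sgn_chi i S x :
  sgn (x i) * chi S x = chi (if i \in S then S :\ i else i |: S) x.
Proof.
case: ifPn => iS; last by rewrite chiU1.
by rewrite -[in LHS](setD1K iS) chiU1 ?setD11 // mulrA pm1_sqr mul1r.
Qed.

(** The sum over S is the expanded product of the factors 1 + x_i y_i; a coordinate where x and y
    differ makes its factor vanish. *)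
Lemma chi_kernel x y :
  \sum_(S : {set 'I_n}) chi S x * chi S y = (x == y)%:R * #|{: cube n}|%:R.
Proof.
transitivity (\prod_i (sgn (x i) * sgn (y i) + 1)).
  rewrite bigA_distr; apply: eq_bigr => S _.
  by rewrite /chi -big_split big_mkcond.
case: eqVneq => [->|].
  under eq_bigr do rewrite pm1_sqr.
  by rewrite mul1r prodr_const card_ffun card_bool card_ord natrX.
move=> /eqP xy; have [i xi] : exists i, x i != y i.
  apply/existsP; apply: contra_notT xy => /existsPn e; apply/ffunP => i.
  by apply/eqP; move: (e i); rewrite negbK.
rewrite mul0r (bigD1 i) //=.
have -> : sgn (x i) * sgn (y i) + 1 = 0.
  by rewrite -pm1_addb; move: xi; case: (x i); case: (y i) => // _; rewrite /pm1 /= expr1; ring.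
by rewrite mul0r.
Qed.

Lemma parseval g : \sum_(S : {set 'I_n}) fcoef g S ^+ 2 = E (fun x => g x ^+ 2).
Proof.
have N0 := card_cube_gt0; set N := #|_|%:R in N0 *.
transitivity ((\sum_x \sum_y g x * g y * \sum_S chi S x * chi S y) / N ^+ 2).
  under [in RHS]eq_bigr => x _ do (under eq_bigr do rewrite mulr_sumr; rewrite exchange_big /=).
  rewrite exchange_big /= mulr_suml; apply: eq_bigr => S _.
  rewrite /fcoef /expectation expr_div_n expr2 big_distrlr /=.
  congr (_ / _); apply: eq_bigr => x _; apply: eq_bigr => y _; ring.
rewrite /expectation expr2 invfM mulrA -/N; congr (_ / _).
rewrite mulr_suml; apply: eq_bigr => x _.
under eq_bigr do rewrite chi_kernel -/N.
rewrite (bigD1 x) //= big1 => [|y /negPf yx]; last by rewrite eq_sym yx mul0r mulr0.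
by rewrite eqxx addr0 mul1r mulfK ?gt_eqF // expr2.
Qed.

(** * Hypercontractivity by induction on coordinates *)

Lemma sum_subsetU1 i A (F : {set 'I_n} -> R) : i \notin A ->
  \sum_(S : {set 'I_n} | S \subset i |: A) F S = \sum_(S : {set 'I_n} | S \subset A) (F S + F (i |: S)).
Proof.
move=> iA; rewrite (bigID (fun S : {set 'I_n} => i \notin S)) big_split /=; congr (_ + _).
  apply: eq_bigl => S; apply/andP/idP => [[SA iS]|SA].
    by rewrite -(setU1K iA) subsetD1 SA.
  by rewrite (subset_trans SA) ?subsetUr //; split=> //; apply: contra iA; apply: subsetP.
rewrite (reindex_onto (fun S => i |: S) (fun S => S :\ i)) /=; last first.
  by move=> S /andP[_ /negPn iS]; rewrite setD1K.
apply: eq_bigl => S; rewrite setU11 /= andbT.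
apply/andP/idP => [[SA /eqP <-]|SA].
  by rewrite subDset.
have iS : i \notin S by apply: contra iA; apply: subsetP.
by rewrite setUS // setU1K.
Qed.

(** Flipping coordinate i preserves the expectation and negates the integrand. *)
Lemma expectation_pm1_invariant i g :
  (forall x, g (flip i x) = g x) -> E (fun x => sgn (x i) * g x) = 0.
Proof.
move=> gi; set e := E _.
have : e = - e.
  rewrite -[in RHS]mulN1r -expectationZ /e -(expectation_flip i).
  apply: eq_expectation => x.
  by rewrite gi ffunE eqxx pm1_addb /pm1 expr1; ring.
lra.
Qed.

(* The noise rate 1/2, instead of the optimal 1/sqrt 3 of the (2,4)-hypercontractive
   inequality, keeps all constants rational. *)
Definition noisy (c : {set 'I_n} -> R) A x : R :=
  \sum_(S : {set 'I_n} | S \subset A) c S / 2 ^+ #|S| * chi S x.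

Lemma noisyU1 c i A x : i \notin A ->
  noisy c (i |: A) x = noisy c A x + sgn (x i) * (noisy (fun S => c (i |: S)) A x / 2).
Proof.
move=> iA; rewrite /noisy sum_subsetU1 // big_split /=; congr (_ + _).
rewrite mulr_suml mulr_sumr; apply: eq_bigr => S SA.
have iS : i \notin S by apply: contra iA; apply: subsetP.
have e2 : 2 ^+ #|S| != 0 :> R by rewrite expf_neq0 // pnatr_eq0.
by rewrite chiU1 // cardsU1 iS add1n exprS; field.
Qed.

Lemma noisy_flip c i A x : i \notin A -> noisy c A (flip i x) = noisy c A x.
Proof.
move=> iA; apply: eq_bigr => S SA.
by rewrite chi_flip_notin //; apply: contra iA; apply: subsetP.
Qed.

(* Induction on A: for p = q + x_i s / 2 the terms of p^4 odd in x_i average to 0,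
   and the mixed term E[q^2 s^2] is bounded by Cauchy-Schwarz. *)
Lemma bonami A c :
  E (fun x => noisy c A x ^+ 4) <= (\sum_(S : {set 'I_n} | S \subset A) c S ^+ 2) ^+ 2.
Proof.
(* The coefficients c stay general: the part s uses the shifted family c (i |: S). *)
elim: {A}#|A| {-2}A (erefl #|A|) c => [|m IH] A.
  move/eqP; rewrite cards_eq0 => /eqP-> c.
  have s0 (F : {set 'I_n} -> R) : \sum_(S : {set 'I_n} | S \subset set0) F S = F set0.
    by under eq_bigl do rewrite subset0; rewrite big_pred1_eq.
  rewrite (eq_expectation (h := fun x => c set0 ^+ 4 * 1)); last first.
    by move=> x; rewrite /noisy s0 cards0 expr0 /chi big_set0; field.
  by rewrite expectationZ expectation1 mulr1 s0 -exprM.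
move=> Am c.
have /card_gt0P[i iA] : (0 < #|A|)%N by rewrite Am.
have [B [iB AB]] : exists B : {set 'I_n}, i \notin B /\ A = i |: B.
  by exists (A :\ i); rewrite setD11 setD1K.
have {Am iA} Bm : #|B| = m by move: Am; rewrite AB cardsU1 iB => -[].
pose q x := noisy c B x; pose s x := noisy (fun S => c (i |: S)) B x.
(* Binomial expansion of (q + x_i s / 2)^4, with even powers of x_i replaced by 1 and odd ones by
   x_i. *)
rewrite (eq_expectation (h := fun x => (q x ^+ 4 + 3 / 2 * (q x ^+ 2 * s x ^+ 2)
    + 1 / 16 * s x ^+ 4) + sgn (x i) * (2 * q x ^+ 3 * s x + q x * s x ^+ 3 / 2)));
  last first.
  move=> x; rewrite AB noisyU1 // -/(q x) -/(s x).
  have s2 := pm1_sqr (x i); have s3 : sgn (x i) ^+ 3 = sgn (x i).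
    by rewrite exprS expr2 s2 mulr1.
  have s4 : sgn (x i) ^+ 4 = 1 by rewrite (exprD _ 2 2) expr2 s2 mulr1.
  transitivity (q x ^+ 4 + 3 / 2 * (sgn (x i) * sgn (x i)) * (q x ^+ 2 * s x ^+ 2)
    + 1 / 16 * sgn (x i) ^+ 4 * s x ^+ 4
    + (sgn (x i) * (2 * q x ^+ 3 * s x) + sgn (x i) ^+ 3 * (q x * s x ^+ 3 / 2))).
    by field.
  by rewrite s2 s3 s4; ring.
rewrite !expectationD !expectationZ (@expectation_pm1_invariant i) ?addr0; last first.
  by move=> x; rewrite /q /s !noisy_flip.
have Q := IH B Bm c; have T := IH B Bm (fun S => c (i |: S)).
rewrite -/q -/s in Q T; rewrite AB sum_subsetU1 // big_split /=.
set a := \sum_(S | _) c S ^+ 2 in Q *; set b := \sum_(S | _) _ in T *.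
have a0 : 0 <= a by apply: sumr_ge0 => S _; exact: sqr_ge0.
have b0 : 0 <= b by apply: sumr_ge0 => S _; exact: sqr_ge0.
have qs : E (fun x => q x ^+ 2 * s x ^+ 2) <= a * b.
  have qs0 : 0 <= E (fun x => q x ^+ 2 * s x ^+ 2).
    by apply: expectation_ge0 => x; rewrite mulr_ge0 ?sqr_ge0.
  rewrite -(@ler_pXn2r _ 2) ?nnegrE //; last by rewrite mulr_ge0.
  apply: le_trans (expectation_cauchy_schwarz _ _) _; rewrite exprMn.
  apply: ler_pM.
  - by apply: expectation_ge0 => x; rewrite sqr_ge0.
  - by apply: expectation_ge0 => x; rewrite sqr_ge0.
  - by rewrite (eq_expectation (h := fun x => q x ^+ 4)) // => x; rewrite -exprM.
  - by rewrite (eq_expectation (h := fun x => s x ^+ 4)) // => x; rewrite -exprM.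
(* What remains is a^2 + 3/2 a b + b^2 / 16 <= a^2 + 2 a b + b^2. *)
rewrite sqrrD.
nra.
Qed.


(* With X the left-hand sum, X = E[g h] where h is g with each coefficient multiplied
   by 4^-|S|, and E[h^4] <= X^2 by [bonami]; as g takes values in {-1, 0, 1}, two
   uses of Cauchy-Schwarz give X^4 <= E[g^2]^3 E[h^4]. *)
Lemma hypercontractive_indicator g : (forall x, g x ^+ 3 = g x) ->
  (\sum_(S : {set 'I_n}) fcoef g S ^+ 2 / 4 ^+ #|S|) ^+ 2 <= E (fun x => g x ^+ 2) ^+ 3.
Proof.
move=> g3; set X := \sum_S _; set mu := E _.
have X0 : 0 <= X by apply: sumr_ge0 => S _; rewrite divr_ge0 ?sqr_ge0 ?exprn_ge0.
have mu0 : 0 <= mu by apply: expectation_ge0 => x; exact: sqr_ge0.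
(* Half of the damping 4^-|S| sits in c and half in [noisy], so the sum of the c S ^+ 2 is exactly
   X. *)
pose c S := fcoef g S / 2 ^+ #|S|; pose h := noisy c setT.
have e4 S : 4 ^+ #|S| = 2 ^+ #|S| * 2 ^+ #|S| :> R.
  by rewrite -exprMn; congr (_ ^+ _); ring.
have e2 S : 2 ^+ #|S| != 0 :> R by rewrite expf_neq0 // pnatr_eq0.
have h4 : E (fun x => h x ^+ 4) <= X ^+ 2.
  apply: le_trans (bonami _ _) _.
  rewrite le_eqVlt; apply/orP; left; apply/eqP; congr (_ ^+ 2).
  apply: eq_big => [S|S _]; first by rewrite subsetT.
  by rewrite e4 /c; field.
have gh : E (fun x => g x * h x) = X.
  rewrite (eq_expectation (h := fun x => \sum_(S : {set 'I_n} | S \subset setT)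
    c S / 2 ^+ #|S| * (g x * chi S x))).
    rewrite expectation_sum; apply: eq_big => [S|S _]; first by rewrite subsetT.
    by rewrite expectationZ -/(fcoef g S) e4 /c; field.
  by move=> x; rewrite /h /noisy mulr_sumr; apply: eq_bigr => S _; ring.
have step1 : X ^+ 2 <= mu * E (fun x => g x ^+ 2 * h x ^+ 2).
  (* Writing g as g^3 keeps a factor g^2 beside h, which the second Cauchy-Schwarz turns into
     another mu. *)
  rewrite -gh; rewrite (eq_expectation (h := fun x => g x * (g x ^+ 2 * h x))); last first.
    by move=> x; rewrite -{1}g3; ring.
  apply: le_trans (expectation_cauchy_schwarz _ _) _.
  rewrite le_eqVlt; apply/orP; left; apply/eqP; congr (_ * _).
  apply: eq_expectation => x; transitivity (g x ^+ 3 * g x * h x ^+ 2); first by ring.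
  by rewrite g3; ring.
have step2 : E (fun x => g x ^+ 2 * h x ^+ 2) ^+ 2 <= mu * X ^+ 2.
  apply: le_trans (expectation_cauchy_schwarz _ _) _.
  apply: ler_pM; try by apply: expectation_ge0 => x; exact: sqr_ge0.
    rewrite le_eqVlt; apply/orP; left; apply/eqP; apply: eq_expectation => x.
    by transitivity (g x ^+ 3 * g x); [ring | rewrite g3 expr2].
  by rewrite (eq_expectation (h := fun x => h x ^+ 4)) // => x; rewrite -exprM.
(* The two steps give X^4 <= mu^3 X^2; cancelling X^2 requires X > 0. *)
have := X0; rewrite le_eqVlt => /orP[/eqP <-|Xgt0].
  by rewrite expr0n exprn_ge0.
rewrite -(ler_pM2r (exprn_gt0 2 Xgt0)).
have Y0 : 0 <= E (fun x => g x ^+ 2 * h x ^+ 2).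
  by apply: expectation_ge0 => x; rewrite mulr_ge0 ?sqr_ge0.
apply: (@le_trans _ _ ((mu * E (fun x => g x ^+ 2 * h x ^+ 2)) ^+ 2)).
  by rewrite -[X ^+ 2 * _]expr2 (@ler_pXn2r _ 2) // nnegrE; [exact: exprn_ge0 | exact: mulr_ge0].
rewrite exprMn (_ : mu ^+ 3 * X ^+ 2 = mu ^+ 2 * (mu * X ^+ 2)); last by ring.
by rewrite ler_wpM2l ?exprn_ge0.
Qed.

(** * Influences and the KKL inequality *)

Section Boolean.
Context (f : cube n -> bool).

(** Equal to 1 or -1 where flipping i changes f and to 0 elsewhere, so the mean of its square is the
    flip probability. *)
Definition laplacian i x : R := (sgn (f x) - sgn (f (flip i x))) / 2.

Definition influence i : R := E (fun x => laplacian i x ^+ 2).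

Lemma fcoef_laplacian i S : fcoef (laplacian i) S = (i \in S)%:R * fourier R f S.
Proof.
rewrite /fcoef /laplacian.
rewrite (eq_expectation (h := fun x => 1 / 2 * (sgn (f x) * chi S x) +
  (if i \in S then 1 / 2 else - 1 / 2) *
     (sgn (f (flip i x)) * chi S (flip i x)))); last first.
  move=> x; case: ifPn => iS; first by rewrite chi_flip_in //; field.
  by rewrite chi_flip_notin //; field.
rewrite expectationD !expectationZ (expectation_flip i (fun x => sgn (f x) * chi S x)).
rewrite -[E _]/(fourier R f S).
by case: (i \in S) => /=; field.
Qed.

Lemma laplacian_exp3 i x : laplacian i x ^+ 3 = laplacian i x.
Proof.
by rewrite /laplacian /pm1; case: (f x); case: (f _); rewrite ?expr1 ?expr0; field.
Qed.

Lemma influenceE i : influence i = \sum_(S : {set 'I_n} | i \in S) fourier R f S ^+ 2.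
Proof.
rewrite /influence -parseval [RHS]big_mkcond; apply: eq_bigr => S _.
by rewrite fcoef_laplacian; case: (i \in S); rewrite ?mul1r ?mul0r ?expr0n.
Qed.

Lemma exchange_coordinates (F : {set 'I_n} -> R) :
  \sum_i \sum_(S : {set 'I_n} | i \in S) F S = \sum_(S : {set 'I_n}) #|S|%:R * F S.
Proof.
rewrite (exchange_big_dep predT) //=; apply: eq_bigr => S _.
by rewrite sumr_const mulr_natl.
Qed.

Lemma sum_influence : \sum_i influence i = total_influence R f.
Proof.
rewrite /total_influence -(exchange_coordinates (fun S => fourier R f S ^+ 2)).
by apply: eq_bigr => i _; exact: influenceE.
Qed.

Lemma sum_fourier_sqr : \sum_(S : {set 'I_n}) fourier R f S ^+ 2 = 1.
Proof.
rewrite (parseval (fun x => sgn (f x))) -[RHS]expectation1.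
by apply: eq_expectation => x; rewrite expr2 pm1_sqr.
Qed.

(** Let X_i be the damped weight of the sets containing i. Hypercontractivity for [laplacian i]
    gives X_i^2 <= influence i ^3 <= (b * influence i)^2; take roots and sum over i. *)
Lemma kkl (b : R) : 0 <= b -> (forall i, influence i <= b ^+ 2) ->
  \sum_(S : {set 'I_n}) #|S|%:R * (fourier R f S ^+ 2 / 4 ^+ #|S|)
    <= b * total_influence R f.
Proof.
move=> b0 ib; rewrite -(exchange_coordinates (fun S => fourier R f S ^+ 2 / 4 ^+ #|S|)).
rewrite -sum_influence mulr_sumr.
apply: ler_sum => i _.
have i0 : 0 <= influence i by apply: expectation_ge0 => x; exact: sqr_ge0.
have X0 : 0 <= \sum_(S : {set 'I_n} | i \in S) fourier R f S ^+ 2 / 4 ^+ #|S|.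
  by apply: sumr_ge0 => S _; rewrite divr_ge0 ?sqr_ge0 ?exprn_ge0.
rewrite -(@ler_pXn2r _ 2) ?nnegrE //; last by rewrite mulr_ge0.
apply: (@le_trans _ _ (influence i ^+ 3)); last first.
  by rewrite (exprMn _ b) [_ ^+ 3]exprS ler_wpM2r ?exprn_ge0.
apply: le_trans (hypercontractive_indicator (laplacian_exp3 i)).
rewrite le_eqVlt; apply/orP; left; apply/eqP; congr (_ ^+ 2).
rewrite big_mkcond; apply: eq_bigr => S _.
by rewrite fcoef_laplacian; case: (i \in S); rewrite ?mul1r ?mul0r ?expr0n ?mul0r.
Qed.

(** * Terms and influences of a read-k DNF *)

(** Induction on the literals: each indicator (1 + sgn l.2 * x_i) / 2 averages two correlations
    bounded by M. S must vary, since multiplying by x_i toggles i in S. *)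
Lemma term_correlation (M : R) (T : term n) S :
  (forall S', `|fourier R f S'| <= M) ->
  `|E (fun x => sgn (f x) * (eval_term x T)%:R * chi S x)| <= M.
Proof.
move=> fM; elim: T S => [|l T IH] S.
  rewrite (eq_expectation (h := fun x => sgn (f x) * chi S x)); first exact: fM.
  by move=> x; rewrite mulr1.
pose S' := if l.1 \in S then S :\ l.1 else l.1 |: S.
rewrite (eq_expectation (h := fun x =>
    1 / 2 * (sgn (f x) * (eval_term x T)%:R * chi S x) +
    sgn l.2 / 2 * (sgn (f x) * (eval_term x T)%:R * chi S' x))); last first.
  move=> x; rewrite -sgn_chi /= /eval_literal.
  by case: (l.2); case: (x l.1); case: (eval_term x T); rewrite /pm1 ?expr1 ?expr0 /=; field.
rewrite expectationD !expectationZ (le_trans (ler_normD _ _)) //.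
rewrite (normrM (1 / 2)) (normrM (sgn l.2 / 2)).
have := IH S; have := IH S'; set u := `|E _|; set v := `|E _|.
have -> : `|sgn l.2 / 2| = 1 / 2 by rewrite normrM /pm1 normr_sign ger0_norm ?invr_ge0.
have -> : `|1 / 2 : R| = 1 / 2 by rewrite ger0_norm ?divr_ge0.
lra.
Qed.

Section ReadDNF.
Context (phi : dnf n) (phif : eval_dnf phi =1 f).
Context (M : R) (fM : forall S, `|fourier R f S| <= M).

Lemma term_probability (T : term n) : T \in phi ->
  E (fun x => (eval_term x T)%:R) <= M.
Proof.
move=> Tphi; apply: le_trans (term_correlation T set0 fM).
rewrite (eq_expectation (h := fun x => - 1 * (sgn (f x) * (eval_term x T)%:R * chi set0 x))).
  by rewrite expectationZ mulN1r -normrN ler_norm.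
move=> x; rewrite /chi big_set0 mulr1.
case e: (eval_term x T); last by rewrite mulr0n !mulr0.
have -> : f x by rewrite -phif; apply/hasP; exists T.
by rewrite /pm1 expr1 mulr1n; ring.
Qed.

Lemma appears_in_flip i x (T : term n) :
  eval_term x T -> ~~ eval_term (flip i x) T -> appears_in i T.
Proof.
move=> /allP xT /allPn[l lT nl]; apply/hasP; exists l => //.
apply: contraNT nl => /negPf li; have := xT l lT.
by rewrite /eval_literal ffunE li addbF.
Qed.

(** If f changes along the edge, a term true at one end is false at the other, hence mentions i. The
    right side is symmetric in the two ends, so [main] only treats the edge oriented from true to
    false. *)
Lemma laplacian_le_terms i x : laplacian i x ^+ 2 <=
  \sum_(T <- phi | appears_in i T) ((eval_term x T)%:R + (eval_term (flip i x) T)%:R).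
Proof.
have main y z : f y -> ~~ f z -> z = flip i y ->
    1 <= \sum_(T <- phi | appears_in i T) ((eval_term y T)%:R + (eval_term z T)%:R : R).
  rewrite -!phif => /hasP[T Tphi yT] /hasPn zT zy.
  have yT' : ~~ eval_term (flip i y) T by rewrite -zy zT.
  rewrite (big_rem T) //= (appears_in_flip yT yT') yT.
  rewrite -addrA lerDl addr_ge0 ?ler0n ?sumr_ge0 // => T' _.
  by rewrite addr_ge0 ?ler0n.
have [fx|fx] := boolP (f x); have [fy|fy] := boolP (f (flip i x));
  rewrite /laplacian ?(negPf fx) ?(negPf fy) ?fx ?fy /pm1 ?expr1 ?expr0.
- rewrite subrr mul0r expr0n sumr_ge0 // => T _; by rewrite addr_ge0 ?ler0n.
- by apply: le_trans (main _ _ fx fy erefl); lra.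
- under eq_bigr do rewrite addrC.
  by apply: le_trans (main _ _ fy fx _); [lra | rewrite flipK].
- rewrite subrr mul0r expr0n sumr_ge0 // => T _; by rewrite addr_ge0 ?ler0n.
Qed.

Lemma influence_le k i : read_dnf k phi -> influence i <= 2 * k%:R * M.
Proof.
move=> rk; have M0 : 0 <= M := le_trans (normr_ge0 _) (fM set0).
apply: le_trans (ler_expectation (laplacian_le_terms i)) _.
(* Membership in phi is kept in the index, as [term_probability] requires it. *)
rewrite expectation_sum big_seq_cond.
apply: (@le_trans _ _ (\sum_(T <- phi | (T \in phi) && appears_in i T) 2 * M)).
  apply: ler_sum => T /andP[Tphi _]; rewrite expectationD.
  rewrite (expectation_flip i (fun x => (eval_term x T)%:R)).
  have := term_probability Tphi; lra.
rewrite -big_seq_cond big_const_seq iter_addr addr0 -[_ *+ _]mulr_natl.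
have : (count (appears_in i) phi)%:R <= k%:R :> R by rewrite ler_nat; exact: rk.
move: (_%:R) => c; nra.
Qed.

End ReadDNF.
End Boolean.
End Cube.

(** * Min-entropy bounds in the biased and unbiased cases *)

Section MinEntropy.
Context {R : realType} {n : nat} (f : cube n -> bool).
Local Notation fh := (fourier R f).
Local Notation Inf := (total_influence R f).

Lemma min_entropy_le (S : {set 'I_n}) (r : R) :
  fh S != 0 -> - ln (fh S ^+ 2) / ln 2 <= r -> (min_entropy R f <= r%:E)%E.
Proof.
move=> S0 Sr; apply: (bigmin_inf S) => //.
have p : fh S ^+ 2 \is Num.pos by rewrite posrE exprn_even_gt0.
by rewrite lee_fin /log2 div1r lnV.
Qed.

Lemma ln2_ge_half : 1 / 2 <= ln (2 : R).
Proof.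
have := @le_ln1Dx R (- (1 / 2)) ltac:(lra).
have -> : 1 - 1 / 2 = 2^-1 :> R by field.
by rewrite lnV ?posrE //; lra.
Qed.

Lemma variance_fourier :
  1 - fh set0 ^+ 2 = \sum_(S : {set 'I_n} | S != set0) fh S ^+ 2.
Proof. by rewrite -(sum_fourier_sqr f) (bigD1 set0) //= addrAC subrr add0r. Qed.

(** Poincaré inequality: each nonempty S has |S| >= 1. *)
Lemma variance_le_influence : 1 - fh set0 ^+ 2 <= Inf.
Proof.
rewrite variance_fourier /total_influence [leRHS](bigD1 set0) //= cards0 mul0r add0r.
apply: ler_sum => S S0; rewrite ler_peMl ?sqr_ge0 //.
by rewrite ler1n card_gt0.
Qed.

(** The empty set is the witness: ln (1/v) <= 1/v - 1 <= 2 (1 - v) <= 2 Inf, and ln 2 >= 1/2. No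
    additive constant appears, which matters when Inf is small. *)
Lemma min_entropy_biased :
  1 / 2 <= fh set0 ^+ 2 -> (min_entropy R f <= (4 * Inf)%:E)%E.
Proof.
have := variance_le_influence.
have : 0 <= 1 - fh set0 ^+ 2 by rewrite variance_fourier sumr_ge0 // => S _; exact: sqr_ge0.
set v := fh set0 ^+ 2 => v1 vI v2.
have v0 : 0 < v by lra.
apply: (@min_entropy_le set0); first by rewrite -sqrf_eq0 gt_eqF.
rewrite -/v -lnV ?posrE //.
have vV : v^-1 - 1 <= 2 * (1 - v).
  by rewrite -(@ler_pM2l _ v) // mulrBr mulfV ?gt_eqF //; nra.
have : ln v^-1 <= v^-1 - 1.
  by rewrite -{1}[v^-1](subrKC 1) le_ln1Dx // ltrBrDr addNr invr_gt0.
have h2 := ln2_ge_half.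
rewrite ler_pdivrMr; [nra | lra].
Qed.

(** Markov's inequality on degrees: the weight 1 - |S|/d of a nonempty S is at most 1, and negative
    when |S| > d; for |S| <= d the damping is at least 4^-d. *)
Lemma low_degree_weight (d : nat) : (0 < d)%N ->
  (1 - fh set0 ^+ 2 - Inf / d%:R) / 4 ^+ d <=
  \sum_(S : {set 'I_n}) #|S|%:R * (fh S ^+ 2 / 4 ^+ #|S|).
Proof.
move=> d0; have dR : 0 < d%:R :> R by rewrite ltr0n.
have -> : 1 - fh set0 ^+ 2 - Inf / d%:R =
    \sum_(S : {set 'I_n}) ((S != set0)%:R - #|S|%:R / d%:R) * fh S ^+ 2.
  under eq_bigr do rewrite mulrBl mulrAC.
  rewrite big_split /= sumrN -mulr_suml -/Inf; congr (_ - _).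
  rewrite variance_fourier.
  rewrite [RHS](bigD1 set0) //= eqxx mul0r add0r.
  by apply: eq_bigr => S ->; rewrite mul1r.
rewrite mulr_suml; apply: ler_sum => S _.
have c0 := sqr_ge0 (fh S); rewrite [leLHS]mulrAC mulrA [leRHS]mulrAC ler_wpM2r //.
have e0 m : 0 < 4 ^+ m :> R by rewrite exprn_gt0.
have [->|S0] := eqVneq S set0; first by rewrite cards0 !mul0r subrr mul0r.
have s1 : (1 <= #|S|)%N by rewrite card_gt0.
have sR : 1 <= #|S|%:R :> R by rewrite ler1n.
have [Sd|dS] := leqP #|S| d.
  apply: ler_pM; rewrite ?invr_ge0 ?(ltW (e0 _)) //.
  - by rewrite subr_ge0 ler_pdivrMr // mul1r ler_nat.
  - by rewrite (le_trans _ sR) // gerBl divr_ge0 ?ler0n.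
  - by rewrite lef_pV2 ?posrE // ler_weXn2l // ler1n.
apply: (@le_trans _ _ 0); last by rewrite divr_ge0 ?ler0n ?ltW.
rewrite pmulr_lle0 ?invr_gt0 // subr_le0 ler_pdivlMr // mul1r ler_nat.
exact: ltnW.
Qed.

Lemma min_entropy_unbiased (k : nat) (S : {set 'I_n}) : (0 < k)%N ->
  (forall i, influence f i <= 2 * k%:R * `|fh S|) -> fh set0 ^+ 2 < 1 / 2 ->
  (min_entropy R f <= (40 * Inf + 18 + 2 * log2 k%:R)%:E)%E.
Proof.
move=> k0 ik v2; have kR : 0 < k%:R :> R by rewrite ltr0n.
have := variance_le_influence => vI.
set M := `|fh S| in ik; have M0 : 0 <= M by exact: normr_ge0.
set I := Inf in vI *; have I2 : 1 / 2 < I by lra.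
(* d is the floor of 4 I plus one: I/d <= 1/4 then leaves 1/4 of the variance, which exceeds 1/2. *)
have [d [d0 dle dgt]] : exists d : nat, [/\ (0 < d)%N, d%:R - 1 <= 4 * I & 4 * I < d%:R].
  have I4 : 0 <= 4 * I by lra.
  have /andP[lo hi] := truncn_itv I4.
  exists (Num.truncn (4 * I)).+1; split=> //.
  by rewrite -[(_.+1)%:R]natr1 addrK.
have dR : 0 < d%:R :> R by lra.
have B0 : 0 <= 2 * k%:R * M by rewrite !mulr_ge0 ?ler0n.
(* The root of the common influence bound serves as b. *)
have := @kkl R n f (Num.sqrt (2 * k%:R * M)) (sqrtr_ge0 _).
rewrite sqr_sqrtr // => /(_ ik); rewrite -/I.
have := @low_degree_weight d d0; rewrite -/I.
have q : 1 / 4 <= 1 - fh set0 ^+ 2 - I / d%:R.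
  suff : I / d%:R <= 1 / 4 by lra.
  by rewrite ler_pdivrMr //; lra.
move=> lo hi; have {lo hi} := le_trans lo hi.
have e0 : 0 < 4 ^+ d :> R by rewrite exprn_gt0.
have q' : 1 / 4 / 4 ^+ d <= (1 - fh set0 ^+ 2 - I / d%:R) / 4 ^+ d.
  by rewrite ler_wpM2r // invr_ge0 ltW.
move=> /(le_trans q') {q q'} main.
have {main} main : (1 / 4 / 4 ^+ d) ^+ 2 <= 2 * k%:R * M * I ^+ 2.
  rewrite -[X in X * I ^+ 2](sqr_sqrtr B0) -exprMn.
  rewrite (@ler_pXn2r _ 2) // nnegrE; first by rewrite !divr_ge0 // ltW.
  by apply: mulr_ge0; [exact: sqrtr_ge0 | lra].
(* The left side of [main] is positive, so M cannot vanish. *)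
have Mgt : 0 < M.
  rewrite lt_neqAle M0 andbT; apply: contraTneq main => <-.
  by rewrite mulr0 mul0r -ltNge exprn_gt0 // !divr_gt0.
apply: (@min_entropy_le S); first by rewrite -normr_gt0.
rewrite -[fh S ^+ 2]real_normK ?num_real // -/M.
have I0 : 0 < I by lra.
have l2 := ln2_ge_half; have l0 : 0 < ln (2 : R) by lra.
have : ln ((1 / 4 / 4 ^+ d) ^+ 2) <= ln (2 * k%:R * M * I ^+ 2).
  by rewrite ler_ln ?posrE // ?exprn_gt0 ?divr_gt0 ?mulr_gt0 // exprn_gt0.
have -> : (1 / 4 / 4 ^+ d) ^+ 2 = (2 ^+ (4 + 4 * d))^-1 :> R.
  have h4 : 4 = 2 ^+ 2 :> R by ring.
  have -> : 4 ^+ d = (2 ^+ d) ^+ 2 :> R by rewrite h4 exprAC.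
  have -> : 2 ^+ (4 + 4 * d) = 2 ^+ 4 * (2 ^+ d) ^+ 4 :> R.
    by rewrite (exprD (2 : R) 4 (4 * d)) mulnC (exprM (2 : R) d 4).
  have p0 : 2 ^+ d != 0 :> R by rewrite expf_neq0 // pnatr_eq0.
  by field; exact: p0.
have pkM : 0 < 2 * k%:R * M by rewrite mulr_gt0 // mulr_gt0.
have pI : 0 < I ^+ 2 by rewrite exprn_gt0.
have -> : ln (2 ^+ (4 + 4 * d))^-1 = - ((4 + 4 * d%:R) * ln 2) :> R.
  by rewrite lnV ?posrE ?exprn_gt0 // lnXn // -[_ *+ (4 + _)]mulr_natl natrD natrM.
have -> : ln (2 * k%:R * M * I ^+ 2) = ln 2 + ln k%:R + ln M + 2 * ln I.
  rewrite (lnM (x := 2 * k%:R * M)) ?posrE // (lnM (x := 2 * k%:R)) ?posrE ?mulr_gt0 //.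
  by rewrite (lnM (x := 2)) ?posrE // (lnXn 2 I0) mulr_natl.
have lI : ln I <= I.
  by have := @le_ln1Dx R (I - 1) ltac:(lra); rewrite subrKC; lra.
have -> : ln (M ^+ 2) = 2 * ln M by rewrite lnXn // mulr_natl.
rewrite ler_pdivrMr // /log2.
have -> : (40 * I + 18 + 2 * (ln k%:R / ln 2)) * ln 2 = (40 * I + 18) * ln 2 + 2 * ln k%:R.
  by field; rewrite gt_eqF.
(* Logarithms give -2 ln M <= (10 + 8 d) ln 2 + 2 ln k + 4 I. Using d <= 4 I + 1 and I <= 2 I ln 2
   produces the constants 18 and 32 + 8 = 40. *)
have dl : 0 <= (4 * I + 1 - d%:R) * ln 2 by rewrite mulr_ge0 // ?(ltW l0); lra.
have Il : 0 <= I * (ln 2 - 1 / 2) by rewrite mulr_ge0 ?(ltW I0) // subr_ge0.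
lra.
Qed.

End MinEntropy.

Theorem theorem1p9 (R : realType) :
  exists K : R, 0 < K /\
    forall (n k : nat), (1 <= n)%N -> (1 <= k)%N ->
    forall f : cube n -> bool, has_read_dnf k f ->
      (min_entropy R f <= (K * (1 + log2 (k%:R : R)) * total_influence R f)%:E)%E.
Proof.
(* 76 = 40 + 36: in the unbiased case Inf > 1/2, so 18 <= 36 Inf and 2 log2 k <= 4 Inf log2 k. *)
exists 76; split => // n k _ k1 f [phi rk phif].
have lk : 0 <= log2 (k%:R : R) by rewrite divr_ge0 ?ln_ge0 // ler1n.
have vI := variance_le_influence (R := R) f.
have [v2|v2] := lerP (1 / 2) (fourier R f set0 ^+ 2).
  apply: le_trans (min_entropy_biased v2) _; rewrite lee_fin.
  have : 0 <= total_influence R f.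
    by apply: sumr_ge0 => S _; rewrite mulr_ge0 ?ler0n ?sqr_ge0.
  nra.
case: (@arg_maxP _ _ _ set0 predT (fun S => `|fourier R f S|) isT) => S _ maxS.
have ik i := influence_le phif (fun T => maxS T isT) i rk.
apply: le_trans (min_entropy_unbiased k1 ik v2) _; rewrite lee_fin; nra.
Qed.
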